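(* There are universal constants $C\ge C'$ such that the following holds. For all $\ell\ge2$, all $k\in\mathbb{N}_+$ and all $\kappa\in\mathbb{N}_+^\ell$ with $\min_i\{\kappa_i\}\ge\ell^{Ck}$, if $f:\mathcal{U}_\kappa\to\{0,1\}$ has degree at most $k$, then $f$ is an $\ell^{C'k}$-junta.
   Context: With $n=\kappa_1+\cdots+\kappa_\ell$, the multislice is $\mathcal{U}_\kappa=\{u\in[\ell]^n : u \text{ has exactly } \kappa_i \text{ coordinates equal to } i,\ \forall i\in[\ell]\}$. A function $g$ on $\mathcal{U}_\kappa$ is an $m$-junta if there is $J\subseteq[n]$ with $|J|\le m$ such that $g(u)$ depends only on $(u_j)_{j\in J}$. A function $f:\mathcal{U}_\kappa\to\mathbb{R}$ has degree at most $k$ if it is a linear combination of ($\mathbb{R}$-valued) $k$-juntas on $\mathcal{U}_\kappa$. *)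

(* Defs.v *)
From HB Require Import structures.
From mathcomp Require Import all_boot all_order all_algebra.
From mathcomp Require Import reals exp.

Set Implicit Arguments.
Unset Strict Implicit.
Unset Printing Implicit Defensive.

Import Order.TTheory GRing.Theory Num.Theory.
Local Open Scope ring_scope.

Definition in_multislice (l : nat) (kappa : 'I_l -> nat) :
    pred {ffun 'I_(\sum_(i < l) kappa i)%N -> 'I_l} :=
  fun u => [forall i : 'I_l, #|[set j | u j == i]| == kappa i].

Definition multislice (l : nat) (kappa : 'I_l -> nat) : Type :=
  {u : {ffun 'I_(\sum_(i < l) kappa i)%N -> 'I_l} | in_multislice u}.

(* The size bound [m] is a real number, since bounds such as l ^ (C' k) with a
   real constant C' need not be integers. *)
Definition is_junta (R : realType) (l : nat) (kappa : 'I_l -> nat) (m : R)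
    (g : multislice kappa -> R) : Prop :=
  exists J : {set 'I_(\sum_(i < l) kappa i)%N},
    #|J|%:R <= m /\
    forall u v : multislice kappa,
      (forall j, j \in J -> val u j = val v j) -> g u = g v.

Definition degree_le (R : realType) (l : nat) (kappa : 'I_l -> nat) (k : nat)
    (f : multislice kappa -> R) : Prop :=
  exists (N : nat) (c : 'I_N -> R) (g : 'I_N -> multislice kappa -> R),
    (forall i, is_junta k%:R (g i)) /\
    forall u, f u = \sum_(i < N) c i * g i u.

(* Main.v *)
(* Call a pair of coordinates relevant if swapping them changes [f] at some point
   of the multislice.  If all pairs disjoint from a set [T] are irrelevant, then
   swaps outside [T] connect any two points agreeing on [T], so [f] is a [T]-junta;
   hence it suffices to bound the number [M] of pairwise disjoint relevant pairs.
   The iterated discrete derivative of [f] along more than [k] disjoint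
   transpositions vanishes.  Extending a relevant pair [e] to a maximal list of
   disjoint transpositions with nonzero derivative at some [u0], this derivative
   stays nonzero at every point agreeing with [u0] on the at most [2 k] coordinates
   of the list; so any such point can be permuted within these coordinates to one
   at which [f] is sensitive to [e].
   As the [kappa i] are large, one can colour the union [D] of all these
   coordinates uniformly at random and complete the colouring equivariantly; each
   [e] is then sensitive with probability at least [l ^ - (2 k)].  On the other
   hand, restricting [f] to the cube spanned by the disjoint transpositions shows
   that at most [k * 2 ^ k] of them are sensitive at any given point. *)
Require Import Defs.
From mathcomp Require Import all_boot all_order all_algebra fingroup perm.
From mathcomp Require Import reals exp.
From mathcomp Require Import ring zify.

Import Order.TTheory GRing.Theory Num.Theory.
Local Open Scope ring_scope.

Set Implicit Arguments.
Unset Strict Implicit.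
Unset Printing Implicit Defensive.

(** * Polynomial extrapolation and sensitivity on the cube of subsets *)

(** A [k]-th finite difference kills powers below [k]. Exponent 0 is the expansion of
    [(1 - 1) ^+ k]; otherwise one factor [i] is absorbed into the binomial coefficient, which lowers
    [k], and the remaining power of [i] is expanded in powers of [i - 1]. *)
Lemma sum_sign_binomial_expr (R : comNzRingType) (k a : nat) : (a < k)%N ->
  \sum_(i < k.+1) (-1) ^+ i * 'C(k, i)%:R * i%:R ^+ a = 0 :> R.
Proof.
elim: k a => [//|k IHk] [|a] lt_a.
  have := exprDn (1 : R) (-1) k.+1.
  rewrite subrr expr0n /= => E; rewrite [RHS]E.
  by apply: eq_bigr => i _; rewrite expr0 mulr1 expr1n mul1r mulr_natr.
rewrite big_ord_recl /= expr0n /= mulr0 add0r.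
have -> : \sum_(i < k.+1) (-1) ^+ lift ord0 i * 'C(k.+1, lift ord0 i)%:R *
    (lift ord0 i)%:R ^+ a.+1 =
  - k.+1%:R * \sum_(b < a.+1) 'C(a, b)%:R *
     \sum_(i < k.+1) (-1) ^+ i * 'C(k, i)%:R * i%:R ^+ b :> R.
  under [in RHS]eq_bigr do rewrite mulr_sumr.
  rewrite exchange_big /= mulr_sumr; apply: eq_bigr => i _.
  rewrite /= /bump /= add1n [_ ^+ a.+1]exprS.
  have -> : (-1) ^+ i.+1 * 'C(k.+1, i.+1)%:R * (i.+1%:R * i.+1%:R ^+ a) =
            (-1) ^+ i.+1 * (i.+1 * 'C(k.+1, i.+1))%:R * i.+1%:R ^+ a :> R.
    by rewrite natrM; ring.
  rewrite -mul_bin_diag natrM -[in i.+1%:R]add1n natrD exprDn !mulr_sumr.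
  by apply: eq_bigr => b _; rewrite expr1n mul1r -mulr_natr exprS; ring.
rewrite big1 ?mulr0 // => b _; rewrite IHk ?mulr0 //.
by apply: leq_trans (ltn_ord b) _.
Qed.

Lemma prod_if_set (R : comNzRingType) (E : finType) (A : {set E}) (x y : R) :
  \prod_e (if e \in A then x else y) = x ^+ #|A| * y ^+ #|~: A|.
Proof.
rewrite (bigID [in A]) /=; congr (_ * _).
  by rewrite -prodr_const; apply: eq_bigr => e ->.
rewrite -prodr_const; apply: eq_big => [e|e]; first by rewrite inE.
by move/negPf ->.
Qed.

(** For [x] in [0, 1] this is the probability that a random set, taking each element independently
    with probability [x], contains [A]. Expanding a product of sums gives it over any commutative
    ring. *)
Lemma sum_biased_subset (R : comNzRingType) (E : finType) (A : {set E}) (x : R) :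
  \sum_(S : {set E} | A \subset S) \prod_e (if e \in S then x else 1 - x)
  = x ^+ #|A|.
Proof.
have <- : \prod_e (x + (if e \in A then 0 else 1 - x)) = x ^+ #|A|.
  have <- : \prod_e (if e \in A then x else 1) = x ^+ #|A|.
    by rewrite prod_if_set expr1n mulr1.
  by apply: eq_bigr => e _; case: ifP => _; ring.
rewrite bigA_distr big_mkcond /=.
apply: eq_bigr => S _; case: ifPn => [/subsetP sAS | /subsetPn[e eA eS]].
  apply: eq_bigr => e _; case: ifPn => // eS; case: ifPn => // eA.
  by rewrite (sAS _ eA) in eS.
by rewrite (bigD1 e) //= (negPf eS) eA mul0r.
Qed.

(* Extrapolates the derivative at 0 of the polynomial
   [x |-> \sum_A h A * x ^+ #|A|], the [x]-biased average of [Q], from its values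
   at [i / k]. *)
Lemma level_one_bound (R : realFieldType) (E : finType) (k : nat)
    (h Q : {set E} -> R) :
  (forall S, Q S = \sum_(A : {set E} | A \subset S) h A) -> (0 < k)%N ->
  (forall A : {set E}, (k < #|A|)%N -> h A = 0) ->
  (forall S, `|Q S - Q set0| <= 1) ->
  `|\sum_e h [set e]| <= k%:R * 2 ^+ k.
Proof.
move=> QE k_gt0 h0 Q1.
have k0 : k%:R != 0 :> R by rewrite pnatr_eq0 -lt0n.
have Q0 : Q set0 = h set0.
  rewrite QE (eq_bigl (pred1 (set0 : {set E}))) ?big_pred1_eq // => A.
  exact: subset0.
pose P (x : R) := \sum_(S : {set E}) (\prod_e (if e \in S then x else 1 - x)) *
   (Q S - Q set0).
(* An [x]-biased set contains [A] with probability [x ^+ #|A|]; subtracting [Q set0] removes the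
   constant term. *)
have PE x : P x = \sum_(A : {set E} | A != set0) h A * x ^+ #|A|.
  rewrite /P; under eq_bigr => S _.
    have -> : Q S - Q set0 =
        \sum_(A : {set E} | A != set0) (if A \subset S then h A else 0).
      rewrite Q0 QE (bigD1 set0) ?sub0set //= addrAC subrr add0r.
      by rewrite -big_mkcondr; apply: eq_bigl => A; rewrite andbC.
    rewrite mulr_sumr; over.
  rewrite exchange_big /=; apply: eq_bigr => A _.
  rewrite -(sum_biased_subset A x) mulr_sumr [RHS]big_mkcond /=.
  by apply: eq_bigr => S _; case: ifP => _; rewrite ?mulr0 // mulrC.
have P1 x : 0 <= x <= 1 -> `|P x| <= 1.
  move=> /andP[x0 x1]; rewrite /P.
  have W : \sum_(S : {set E}) (\prod_e (if e \in S then x else 1 - x)) = 1.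
    rewrite -[RHS](expr0 x) -(cards0 E) -sum_biased_subset.
    by apply: eq_bigl => S; rewrite sub0set.
  rewrite -[leRHS]W; apply: (le_trans (ler_norm_sum _ _ _)).
  apply: ler_sum => S _.
  have w0 : 0 <= \prod_e (if e \in S then x else 1 - x).
    by apply: prodr_ge0 => e _; case: ifP => _ //; rewrite subr_ge0.
  by rewrite normrM (ger0_norm w0) ler_piMr.
(* The weight [k / i] cancels one factor of [(i / k) ^+ #|A|], leaving a finite difference with
   exponent [#|A| - 1 < k]. Its term at 0 is absent from the sum, and is nonzero only when
   [#|A| = 1]. *)
have key : \sum_(i < k) (-1) ^+ i.+1 * 'C(k, i.+1)%:R * (k%:R / i.+1%:R) *
   P (i.+1%:R / k%:R) = - \sum_e h [set e].
  under eq_bigr => i _ do rewrite PE mulr_sumr.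
  rewrite exchange_big /=.
  have E1 (A : {set E}) : A != set0 -> \sum_(i < k) (-1) ^+ i.+1 * 'C(k, i.+1)%:R *
      (k%:R / i.+1%:R) * (h A * (i.+1%:R / k%:R) ^+ #|A|) =
      - (if #|A| == 1%N then h A else 0).
    move=> A0; have [/h0 ->|leAk] := ltnP k #|A|.
      rewrite big1; last by move=> i _; rewrite mul0r mulr0.
      by case: ifP; rewrite oppr0.
    have {}A0 : (0 < #|A|)%N by rewrite card_gt0.
    case: #|A| A0 leAk => // a _ lt_ak.
    have := sum_sign_binomial_expr R lt_ak.
    rewrite big_ord_recl /= expr0 bin0 !mul1r eqSS => /eqP.
    rewrite addrC addr_eq0 => /eqP S0.
    transitivity (h A * k%:R^-1 ^+ a * (- 0%:R ^+ a)).
      rewrite -S0 mulr_sumr; apply: eq_bigr => i _.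
      have i0 : i.+1%:R != 0 :> R by rewrite pnatr_eq0.
      rewrite /bump /= add1n exprMn !exprS.
      have -> : (-1) * (-1) ^+ i * 'C(k, i.+1)%:R * (k%:R / i.+1%:R) *
        (h A * (i.+1%:R * i.+1%:R ^+ a * (k%:R^-1 * k%:R^-1 ^+ a))) =
        (k%:R / k%:R) * (i.+1%:R / i.+1%:R) * (h A * k%:R^-1 ^+ a *
        ((-1) * (-1) ^+ i * 'C(k, i.+1)%:R * i.+1%:R ^+ a)) :> R by ring.
      by rewrite !divff // !mul1r.
    by rewrite expr0n; case: a {lt_ak S0} => [|a] /=; rewrite ?expr0; ring.
  rewrite (eq_bigr _ E1) sumrN; congr (- _).
  rewrite -big_mkcondr /=.
  rewrite -(big_imset (h := fun e => [set e]) h (A := predT)) /=; last first.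
    by move=> x y _ _ /set1_inj.
  apply: eq_bigl => A; rewrite andbC.
  apply/andP/imsetP => [[/cards1P[e ->] _]|[e _ ->]]; first by exists e.
  by rewrite cards1; split=> //; rewrite -cards_eq0 cards1.
(* Each weight is at most [k] times a binomial coefficient, and [P] is at most 1 in absolute value
   at the nodes. *)
rewrite -normrN -key; apply: (le_trans (ler_norm_sum _ _ _)).
have -> : 2 ^+ k = \sum_(i < k.+1) 'C(k, i)%:R :> R.
  rewrite -[2]/(1 + 1) exprDn; apply: eq_bigr => i _.
  by rewrite !expr1n mul1r.
rewrite mulr_sumr big_ord_recl /= ler_wpDl ?mulr_ge0 ?ler0n //.
apply: ler_sum => i _; rewrite /bump /= add1n !normrM.
have -> : `|(-1) ^+ i.+1| = 1 :> R by rewrite normrX normrN1 expr1n.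
rewrite mul1r normr_nat -[leRHS]mulrC -mulrA ler_wpM2l ?ler0n //.
have i0 : 0 < i.+1%:R :> R by rewrite ltr0n.
rewrite -[leRHS]mulr1; apply: ler_pM; rewrite ?mulr_ge0 ?normr_ge0 //; last first.
  apply: P1; rewrite divr_ge0 ?ler0n //= ler_pdivrMr ?ltr0n //.
  by rewrite mul1r ler_nat.
rewrite ger0_norm ?divr_ge0 ?ler0n // normfV normr_nat ler_piMr ?ler0n //.
by rewrite invf_le1 // ler1n.
Qed.

(** Write [g] as the sum over [B] inside [K] of [g B] times the indicator of [S :&: K = B], and
    expand each indicator into monomials. *)
Lemma set_junta_monomials (R : comNzRingType) (E : finType) (K : {set E})
    (g : {set E} -> R) : (forall S, g S = g (S :&: K)) ->
  exists2 h : {set E} -> R, (forall A : {set E}, ~~ (A \subset K) -> h A = 0) &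
    forall S, g S = \sum_(A : {set E} | A \subset S) h A.
Proof.
move=> gK.
(* The indicator is a product of factors [f B e * x_e + f' B e]: [x_e] for [e] in [B], [1 - x_e] for
   [e] in [K] but not in [B], and 1 outside [K]. *)
pose f (B : {set E}) e : R := if e \in K then (if e \in B then 1 else -1) else 0.
pose f' (B : {set E}) e : R := if (e \in K) && (e \in B) then 0 else 1.
pose h (A : {set E}) := \sum_(B : {set E} | B \subset K)
  g B * \prod_e (if e \in A then f B e else f' B e).
exists h => [A /subsetPn[e eA eK]|S].
  apply: big1 => B _; rewrite (bigD1 e) //= eA /f (negPf eK).
  by rewrite mul0r mulr0.
rewrite /h exchange_big /= gK (bigD1 (S :&: K)) ?subsetIr //=.
have E1 (B : {set E}) : \sum_(A : {set E} | A \subset S)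
    g B * \prod_e (if e \in A then f B e else f' B e)
  = g B * \prod_e ((if e \in S then f B e else 0) + f' B e).
  rewrite -mulr_sumr bigA_distr; congr (_ * _); rewrite big_mkcond /=.
  apply: eq_bigr => A _; case: ifPn => [/subsetP sAS | /subsetPn[e eA eS]].
    by apply: eq_bigr => e _; case: ifPn => // /sAS ->.
  by rewrite (bigD1 e) //= eA (negPf eS) mul0r.
rewrite E1 big1 ?mulr1 => [|e _]; last first.
  rewrite /f /f' inE; case: (e \in S); case: (e \in K) => /=; ring.
rewrite big1 ?addr0 // => B /andP[sBK neB]; rewrite E1.
have [e eK neq] : exists2 e, e \in K & (e \in S) != (e \in B).
  apply/exists_inP; apply: contraR neB; rewrite negb_exists_in => /forall_inP H.
  apply/eqP/setP => e; rewrite inE; have [/H|eK] := boolP (e \in K).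
    by rewrite negbK andbT => /eqP.
  by rewrite andbF; apply/negP => /(subsetP sBK); rewrite (negPf eK).
rewrite (bigD1 e) //= /f /f' eK /=.
case: (e \in S) neq; case: (e \in B) => // _; first by rewrite addNr mul0r mulr0.
by rewrite addr0 mul0r mulr0.
Qed.

(** As [q] takes only the values 0 and 1, all differences [q [set e] - q set0] have the same sign.
    Nothing cancels in the level-one sum, so its absolute value counts the sensitive [e]. *)
Lemma sensitivity_bound (R : realFieldType) (E : finType) (k N : nat)
    (c : 'I_N -> R) (g : 'I_N -> {set E} -> R) (K : 'I_N -> {set E})
    (q : {set E} -> R) :
  (0 < k)%N -> (forall i, #|K i| <= k)%N ->
  (forall i S, g i S = g i (S :&: K i)) ->
  (forall S, q S = \sum_(i < N) c i * g i S) ->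
  (forall S, q S = 0 \/ q S = 1) ->
  (#|[set e | q [set e] != q set0]| <= k * 2 ^ k)%N.
Proof.
move=> k_gt0 Kk gK qE q01.
have [h hK hE] : exists2 h : 'I_N -> {set E} -> R,
   (forall i (A : {set E}), ~~ (A \subset K i) -> h i A = 0) &
   forall i S, g i S = \sum_(A : {set E} | A \subset S) h i A.
  have /fin_all_exists2[h h1 h2] := fun i => set_junta_monomials (gK i).
  by exists h.
pose H (A : {set E}) := \sum_(i < N) c i * h i A.
have qH S : q S = \sum_(A : {set E} | A \subset S) H A.
  rewrite qE exchange_big /=; apply: eq_bigr => i _.
  by rewrite hE mulr_sumr.
have H0 (A : {set E}) : (k < #|A|)%N -> H A = 0.
  move=> ltkA; apply: big1 => i _; rewrite hK ?mulr0 //.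
  by apply: contraL ltkA => /subset_leq_card leA; rewrite -leqNgt (leq_trans leA).
have q1 S : `|q S - q set0| <= 1.
  case: (q01 S) => ->; case: (q01 set0) => ->;
  by rewrite ?subrr ?subr0 ?sub0r ?normrN ?normr0 ?normr1 ?ler01 ?lexx.
have := level_one_bound qH k_gt0 H0 q1.
have HE e : H [set e] = q [set e] - q set0.
  have -> : q set0 = H set0.
    rewrite qH (eq_bigl (pred1 (set0 : {set E}))) ?big_pred1_eq // => A.
    exact: subset0.
  rewrite qH.
  rewrite (bigD1 set0) ?sub0set //= addrAC subrr add0r (bigD1 [set e]) /=; last first.
    by rewrite subxx -cards_eq0 cards1.
  by rewrite big1 ?addr0 // => A; rewrite subset1 => /andP[/andP[/orP[]->]].
have -> : `|\sum_e H [set e]| = #|[set e | q [set e] != q set0]|%:R.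
  rewrite cardsE -sum1_card natr_sum [in RHS]big_mkcond /=.
  case: (q01 set0) => q0; last rewrite -normrN -sumrN.
    rewrite -[RHS]ger0_norm ?sumr_ge0 //; last by move=> e _; case: ifP.
    congr `| _ |; apply: eq_bigr => e _; rewrite HE q0 unfold_in /=.
    by case: (q01 [set e]) => ->; rewrite ?eqxx ?oner_eq0 /= subr0.
  rewrite -[RHS]ger0_norm ?sumr_ge0 //; last by move=> e _; case: ifP.
  congr `| _ |; apply: eq_bigr => e _; rewrite HE q0 unfold_in /=.
  by case: (q01 [set e]) => ->; rewrite ?eqxx 1?eq_sym ?oner_eq0 /=; ring.
by rewrite -natrX -natrM ler_nat.
Qed.

(** * Colourings, swaps and connectivity of the multislice *)

Definition act (I C : finType) (u : {ffun I -> C}) (s : {perm I}) :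
  {ffun I -> C} := [ffun x => u (s x)].

Definition swap (I C : finType) (u : {ffun I -> C}) (e : I * I) :=
  act u (tperm e.1 e.2).

(** A sequence rather than a set, so that [uniq (supp p)] says both that the pairs are disjoint and
    that each has distinct entries. *)
Definition supp (I : eqType) (p : seq (I * I)) : seq I :=
  flatten [seq [:: e.1; e.2] | e <- p].

(** The multislice condition over arbitrary finite types, kept as a predicate so that functions can
    be total on all colourings. *)
Definition has_counts (I C : finType) (kap : C -> nat) :
    pred {ffun I -> C} :=
  fun u => [forall a, #|[set j | u j == a]| == kap a].

Definition depends_on (I C : finType) (V : Type) (J : {set I})
    (g : {ffun I -> C} -> V) :=
  forall u v : {ffun I -> C}, {in J, u =1 v} -> g u = g v.

Lemma act1 (I C : finType) (u : {ffun I -> C}) : act u 1%g = u.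
Proof. by apply/ffunP => x; rewrite ffunE perm1. Qed.

Lemma actM (I C : finType) (u : {ffun I -> C}) (s t : {perm I}) :
  act (act u s) t = act u (t * s)%g.
Proof. by apply/ffunP => x; rewrite !ffunE permM. Qed.

Lemma swapE (I C : finType) (u : {ffun I -> C}) (e : I * I) x :
  swap u e x = u (tperm e.1 e.2 x).
Proof. by rewrite ffunE. Qed.

Lemma swap_out (I C : finType) (u : {ffun I -> C}) (e : I * I) x :
  x != e.1 -> x != e.2 -> swap u e x = u x.
Proof. by move=> x1 x2; rewrite swapE tpermD // eq_sym. Qed.

Lemma swap_id (I C : finType) (u : {ffun I -> C}) i : swap u (i, i) = u.
Proof. by rewrite /swap tperm1 act1. Qed.

Lemma suppP (I : eqType) (p : seq (I * I)) x :
  reflect (exists2 e, e \in p & (x == e.1) || (x == e.2)) (x \in supp p).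
Proof.
apply: (iffP flatten_mapP) => -[e ep xe]; exists e => //;
by move: xe; rewrite !inE.
Qed.

Lemma supp_fst (I : eqType) (p : seq (I * I)) e : e \in p -> e.1 \in supp p.
Proof. by move=> ep; apply/suppP; exists e; rewrite ?eqxx. Qed.

Lemma size_supp (I : eqType) (p : seq (I * I)) : size (supp p) = (size p).*2.
Proof. by elim: p => //= e p ->; rewrite doubleS. Qed.

Lemma has_counts_act (I C : finType) (kap : C -> nat) (u : {ffun I -> C}) s :
  has_counts kap (act u s) = has_counts kap u.
Proof.
apply: eq_forallb => a; congr (_ == _).
rewrite -[RHS](card_preimset _ (@perm_inj _ s)); apply: eq_card => j.
by rewrite !inE ffunE.
Qed.

Lemma has_counts_swap (I C : finType) (kap : C -> nat) (u : {ffun I -> C}) e :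
  has_counts kap (swap u e) = has_counts kap u.
Proof. exact: has_counts_act. Qed.

(** Induction on the number of disagreements with [v]. If [u i != v i], equal counts of the colour
    [v i] give [j] with [u j = v i] and [v j != v i]. Swapping [i] and [j] repairs [i], and [j] was
    already a disagreement; both lie outside [T]. *)
Lemma swap_connected (I C : finType) (V : Type) (kap : C -> nat) (T : {set I})
    (H : {ffun I -> C} -> V) (u v : {ffun I -> C}) :
  has_counts kap u -> has_counts kap v -> {in T, u =1 v} ->
  (forall w i j, has_counts kap w -> {in T, w =1 v} -> i \notin T ->
     j \notin T -> H (swap w (i, j)) = H w) ->
  H u = H v.
Proof.
move=> Uu Uv uv swapH.
have [m] := ubnP #|[set x | u x != v x]|.
elim: m u Uu uv => // m IHm u Uu uv ltm.
have [/eqP -> //|neuv] := boolP (u == v).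
have [i ui] : exists i, u i != v i.
  apply/existsP; apply: contraR neuv; rewrite negb_exists => /forallP H0.
  by apply/eqP/ffunP => x; apply/eqP; have := H0 x; rewrite negbK.
have [j uj vj] : exists2 j, u j = v i & v j != v i.
  have : ~~ ([set j | u j == v i] \subset [set j | v j == v i] :\ i).
    apply/negP => /subset_leq_card; move: Uu Uv.
    move=> /forallP/(_ (v i))/eqP -> /forallP/(_ (v i))/eqP.
    by rewrite (cardsD1 i) inE eqxx => <-; rewrite add1n ltnn.
  case/subsetPn => j; rewrite !inE negb_and negbK => /eqP uj vj; exists j => //.
  case/orP: vj => // /eqP ji; move: ui.
  by rewrite -{1}ji uj eqxx.
have iT : i \notin T by apply: contra ui => /uv ->.
have jT : j \notin T by apply: contra vj => /uv <-; rewrite uj.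
rewrite -(swapH u i j) //; apply: IHm; first by rewrite has_counts_swap.
  move=> x xT; rewrite swap_out ?uv //=.
    by apply: contraNneq iT => <-.
  by apply: contraNneq jT => <-.
apply: leq_trans (_ : #|[set x | u x != v x]| <= m)%N; last by rewrite -ltnS.
apply: proper_card; apply/properP; split; last first.
  by exists i; rewrite !inE ?swapE ?tpermL //= uj eqxx.
apply/subsetP => x; rewrite !inE swapE /=.
by case: tpermP => [->|->|_ _ //]; rewrite uj ?eqxx // [v i == _]eq_sym vj.
Qed.

(** * Completing and counting partial colourings *)

(** Coordinates are fixed one at a time: the class of the wanted colour is too large to lie inside
    the coordinates already fixed, so that colour can be swapped in from elsewhere. *)
Lemma completion (I C : finType) (kap : C -> nat) (r : seq I)
    (u z : {ffun I -> C}) :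
  has_counts kap u -> uniq r -> (forall a, size r <= kap a)%N ->
  exists2 w, has_counts kap w & {in r, w =1 z}.
Proof.
move=> Uu; elim: r => [|x r IHr] /=; first by exists u.
case/andP => xr ur leka.
have [|w Uw wz] := IHr ur; first by move=> a; apply: ltnW.
have [j jw jr] : exists2 j, w j = z x & j \notin r.
  have : ~~ ([set j | w j == z x] \subset r).
    apply/negP => /subset_leq_card; move/forallP: Uw => /(_ (z x))/eqP ->.
    by rewrite leqNgt (leq_ltn_trans (card_size r)) ?leka.
  by case/subsetPn => j; rewrite inE => /eqP; exists j.
exists (swap w (x, j)); first by rewrite has_counts_swap.
move=> y; rewrite inE => /predU1P[->|yr]; first by rewrite swapE tpermL.
rewrite swap_out ?wz //=; first by apply: contraNneq xr => <-.
by apply: contraNneq jr => <-.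
Qed.

(* The values outside [D] are chosen from the colour counts on [D] alone, which
   makes the completion commute with permutations of [D]. *)
Lemma equivariant_completion (I C : finType) (kap : C -> nat) (D : {set I})
    (u : {ffun I -> C}) :
  has_counts kap u -> (forall a, #|D| <= kap a)%N ->
  exists phi : {ffun I -> C} -> {ffun I -> C},
    [/\ forall z, has_counts kap (phi z), forall z : {ffun I -> C}, {in D, phi z =1 z} &
        forall z s, perm_on D s -> phi (act z s) = act (phi z) s].
Proof.
move=> Uu leD.
pose Q (z w : {ffun I -> C}) := [forall a, (#|[set x in D | z x == a]| +
   #|[set x in ~: D | w x == a]|)%N == kap a].
(* The default [u] is never reached: [rP] shows that a suitable [w] always exists. *)
pose r z := odflt u [pick w | Q z w].
pose phi (z : {ffun I -> C}) : {ffun I -> C} :=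
  [ffun x => if x \in D then z x else r z x].
have split_count (w : {ffun I -> C}) a : (#|[set x in D | w x == a]| +
    #|[set x in ~: D | w x == a]| = #|[set x | w x == a]|)%N.
  rewrite -(cardsID D [set x | w x == a]); congr (_ + _)%N;
  by apply: eq_card => x; rewrite !inE // andbC.
have rP z : Q z (r z).
  rewrite /r; case: pickP => // noQ.
  have [|w Uw wz] := completion z Uu (enum_uniq (mem D)).
    by move=> a; rewrite -cardE.
  have /negP[] := noQ w; apply/forallP => a.
  have -> : #|[set x in D | z x == a]| = #|[set x in D | w x == a]|.
    apply: eq_card => x; rewrite !inE; case: (boolP (x \in D)) => //= xD.
    by rewrite wz // mem_enum.
  by rewrite split_count; apply: (forallP Uw).
exists phi; split=> [z|z x xD|z s sD].
- apply/forallP => a; rewrite -split_count -(eqP (forallP (rP z) a)).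
  apply/eqP; congr (_ + _)%N; apply: eq_card => x; rewrite !inE ffunE;
  by case: (x \in D).
- by rewrite ffunE xD.
have rs : r (act z s) = r z.
  congr odflt; apply: eq_pick => w; apply: eq_forallb => a; congr (_ + _ == _)%N.
  rewrite -[RHS](card_preimset _ (@perm_inj _ s)); apply: eq_card => x.
  by rewrite !inE ffunE perm_closed.
apply/ffunP => x; rewrite !ffunE perm_closed // rs.
by case: ifPn => // xD; rewrite (out_perm sD).
Qed.

(** Multiplying by [#|C| ^ #|T|] avoids a subtraction in the exponent. *)
Lemma card_agree (I C : finType) (T : {set I}) (v : {ffun I -> C}) :
  (#|[set z : {ffun I -> C} | [forall x in T, z x == v x]]| * #|C| ^ #|T|
   = #|C| ^ #|I|)%N.
Proof.
pose F x : pred C := if x \in T then pred1 (v x) else predT.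
have -> : #|[set z : {ffun I -> C} | [forall x in T, z x == v x]]| =
    #|(family F : pred {ffun I -> C})|.
  rewrite cardsE; apply: eq_card => z; rewrite !unfold_in /=.
  by apply: eq_forallb => x; rewrite /F; case: (x \in T).
rewrite card_family foldrE big_map big_enum /=.
rewrite (bigID [in T]) /= big1 ?mul1n => [|x xT]; last by rewrite /F xT card1.
rewrite (eq_bigr (fun=> #|C|)) => [|x xT]; last first.
  by rewrite /F (negPf xT); apply: eq_card.
by rewrite prod_nat_const -expnD addnC cardC.
Qed.

(** * Discrete derivatives along disjoint transpositions *)

(** Unfolded, an alternating sum of [F] over the colourings obtained from [u] by performing a subset
    of the swaps. *)
Fixpoint deriv (R : zmodType) (I C : finType) (F : {ffun I -> C} -> R)
    (p : seq (I * I)) (u : {ffun I -> C}) : R :=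
  if p is e :: p' then deriv F p' u - deriv F p' (swap u e) else F u.

Lemma deriv_sum (R : comNzRingType) (I C : finType) (N : nat) (c : 'I_N -> R)
    (g : 'I_N -> {ffun I -> C} -> R) (F : {ffun I -> C} -> R) p u :
  (forall v, F v = \sum_(i < N) c i * g i v) ->
  deriv F p u = \sum_(i < N) c i * deriv (g i) p u.
Proof.
move=> FE; elim: p u => [|e p IHp] u /=; first exact: FE.
by rewrite !IHp -sumrB; apply: eq_bigr => i _; rewrite mulrBr.
Qed.

Lemma swap_comm (I C : finType) (u : {ffun I -> C}) (e e' : I * I) :
  e.1 \notin [:: e'.1; e'.2] -> e.2 \notin [:: e'.1; e'.2] ->
  swap (swap u e) e' = swap (swap u e') e.
Proof.
rewrite !inE !negb_or => /andP[e11 e12] /andP[e21 e22].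
rewrite /swap !actM; congr act; apply/permP => x; rewrite !permM.
case: (tpermP e'.1 e'.2 x) => [->|->|/eqP xe1 /eqP xe2].
- by rewrite !(@tpermD _ e.1 e.2) // tpermL.
- by rewrite !(@tpermD _ e.1 e.2) // tpermR.
have xn : tperm e.1 e.2 x != e'.1 /\ tperm e.1 e.2 x != e'.2.
  by case: tpermP.
by case: xn => n1 n2; rewrite [RHS]tpermD // eq_sym.
Qed.

Lemma deriv_swap_invariant (R : zmodType) (I C : finType)
    (F : {ffun I -> C} -> R) p e u :
  (forall v, F (swap v e) = F v) -> e.1 \notin supp p -> e.2 \notin supp p ->
  deriv F p (swap u e) = deriv F p u.
Proof.
move=> Fe; elim: p u => [|e' p IHp] u //=.
rewrite !inE !negb_or => /and3P[e11 e12 e1p] /and3P[e21 e22 e2p].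
by rewrite swap_comm ?IHp ?inE ?negb_or ?e11 ?e12 ?e21.
Qed.

(** The swap of [e] commutes with the other swaps, so the difference taken along [e] vanishes. *)
Lemma deriv_eq0 (R : zmodType) (I C : finType) (F : {ffun I -> C} -> R) p e u :
  uniq (supp p) -> e \in p -> (forall v, F (swap v e) = F v) ->
  deriv F p u = 0.
Proof.
move=> up ep Fe; elim: p u up ep => //= e' p IHp u.
rewrite !inE !negb_or => /and3P[/andP[_ e1] e2 up] /predU1P[ee'|ep].
  by rewrite -ee' deriv_swap_invariant ?subrr // ee'.
by rewrite !IHp // subrr.
Qed.

Lemma depends_on_swap (I C : finType) (V : Type) (J : {set I})
    (g : {ffun I -> C} -> V) e :
  depends_on J g -> e.1 \notin J -> e.2 \notin J ->
  forall v, g (swap v e) = g v.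
Proof.
move=> gJ e1 e2 v; apply: gJ => x xJ; apply: swap_out.
  by apply: contraNneq e1 => <-.
by apply: contraNneq e2 => <-.
Qed.

Lemma supp_uniq_eq (I : eqType) (p : seq (I * I)) e e' x :
  uniq (supp p) -> e \in p -> e' \in p -> x \in [:: e.1; e.2] ->
  x \in [:: e'.1; e'.2] -> e = e'.
Proof.
elim: p => // f p IHp; rewrite -[supp _]/([:: f.1; f.2] ++ supp p).
rewrite cat_uniq => /and3P[_ /hasPn disj up].
have out e0 : e0 \in p -> x \in [:: e0.1; e0.2] -> x \notin [:: f.1; f.2].
  move=> e0p xe0; apply: disj; apply/suppP; exists e0 => //.
  by move: xe0; rewrite !inE.
rewrite (in_cons f p e) (in_cons f p e') => /predU1P[->|ep] /predU1P[->|e'p] xe xe' //.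
- by have := out _ e'p xe'; rewrite xe.
- by have := out _ ep xe; rewrite xe'.
exact: IHp.
Qed.

(** By disjointness a point lies in at most one pair, so sending each point of [J] to its pair
    covers all pairs that meet [J]. *)
Lemma card_pairs_meeting (I : finType) (p : seq (I * I)) (J : {set I}) :
  uniq (supp p) ->
  (#|[set e in p | (e.1 \in J) || (e.2 \in J)]| <= #|J|)%N.
Proof.
move=> up; case: p up => [|e0 p] up.
  by rewrite (eq_card (B := pred0)) ?card0 // => e; rewrite !inE.
(* Points in no pair are sent to the default [e0]. *)
pose f x := nth e0 (e0 :: p) (find (fun e => x \in [:: e.1; e.2]) (e0 :: p)).
apply: leq_trans (leq_imset_card f (mem J)); apply: subset_leq_card.
apply/subsetP => e; rewrite inE => /andP[ep eJ].
have fE x : x \in [:: e.1; e.2] -> f x = e.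
  move=> xe; have hx : has (fun e => x \in [:: e.1; e.2]) (e0 :: p).
    by apply/hasP; exists e.
  by apply: (@supp_uniq_eq _ (e0 :: p) _ _ x) => //;
    [rewrite mem_nth // -has_find | exact: (nth_find e0 hx)].
case/orP: eJ => eJ; apply/imsetP; [exists e.1 | exists e.2] => //;
by rewrite fE // !inE eqxx ?orbT.
Qed.

Lemma uniq_supp (I : eqType) (p : seq (I * I)) : uniq (supp p) -> uniq p.
Proof.
elim: p => //= e p IHp; rewrite inE negb_or -andbA => /and4P[_ e1 _ /IHp ->].
by rewrite andbT; apply: contra e1 => /supp_fst.
Qed.

(** Among more than [k] disjoint pairs one misses [J i]; its swap leaves [g i] unchanged and so
    kills the derivative of [g i]. *)
Lemma deriv_degree (R : comNzRingType) (I C : finType) (k N : nat)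
    (c : 'I_N -> R) (g : 'I_N -> {ffun I -> C} -> R) (J : 'I_N -> {set I})
    (F : {ffun I -> C} -> R) p u :
  (forall i, depends_on (J i) (g i)) -> (forall i, #|J i| <= k)%N ->
  (forall v, F v = \sum_(i < N) c i * g i v) ->
  uniq (supp p) -> (k < size p)%N -> deriv F p u = 0.
Proof.
move=> gJ Jk FE up ltkp; rewrite (deriv_sum _ _ FE) big1 // => i _.
have : ~~ ([set e in p] \subset
           [set e in p | (e.1 \in J i) || (e.2 \in J i)]).
  apply/negP => /subset_leq_card; rewrite leqNgt => /negP[].
  apply: leq_ltn_trans (card_pairs_meeting (J i) up) _.
  by rewrite cardsE (card_uniqP (uniq_supp up)) (leq_ltn_trans (Jk i)).
case/subsetPn => e; rewrite !inE => ep; rewrite ep negb_or => /andP[e1 e2].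
by rewrite (deriv_eq0 _ up ep) ?mulr0 //; apply: depends_on_swap (gJ i) _ _.
Qed.

(* Take a maximal extension with nonvanishing derivative at some point: then no
   swap of the remaining coordinates changes the derivative. *)
Lemma rigid_derivative (R : comNzRingType) (I C : finType) (kap : C -> nat)
    (k N : nat)
    (c : 'I_N -> R) (g : 'I_N -> {ffun I -> C} -> R) (J : 'I_N -> {set I})
    (F : {ffun I -> C} -> R) p u :
  (forall i, depends_on (J i) (g i)) -> (forall i, #|J i| <= k)%N ->
  (forall v, F v = \sum_(i < N) c i * g i v) ->
  uniq (supp p) -> has_counts kap u -> deriv F p u != 0 ->
  exists p' (u0 : {ffun I -> C}), [/\ uniq (supp (p' ++ p)), (size (p' ++ p) <= k)%N &
    forall v, has_counts kap v -> {in supp (p' ++ p), v =1 u0} ->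
      deriv F (p' ++ p) v != 0].
Proof.
move=> gJ Jk FE.
(* Maximality is obtained by induction on the remaining room, as a nonzero derivative has length at
   most [k]. *)
have [m] := ubnP (k.+1 - size p)%N.
elim: m p u => // m IHm p u ltm up Uu pu.
have lepk : (size p <= k)%N.
  by rewrite leqNgt; apply: contra pu => /(deriv_degree u gJ Jk FE up) ->.
have [/existsP[w /existsP[e /and5P[Uw /forall_inP wu e1 e2 dw]]]|rigid] := boolP
   [exists w : {ffun I -> C}, exists e : I * I,
     [&& has_counts kap w, [forall x in supp p, w x == u x], e.1 \notin supp p,
         e.2 \notin supp p & deriv F p (swap w e) != deriv F p w]].
  have [||||p' [u0 [up' sp' Hp']]] := IHm (e :: p) w.
  - by move: ltm; rewrite subSn.
  - rewrite /= !inE negb_or e1 e2 up !andbT /=.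
    by apply: contraNneq dw; case: e {e1 e2} => i j /= ->; rewrite swap_id.
  - by [].
  - by rewrite /= subr_eq0 eq_sym.
  by exists (rcons p' e), u0; rewrite cat_rcons.
exists [::], u; split=> // v Uv vu.
suff -> : deriv F p v = deriv F p u by [].
apply: (swap_connected (T := [set x in supp p]) Uv Uu) => [x|w i j Uw wu iT jT].
  by rewrite inE => /vu.
apply/eqP; apply: contraR rigid => dw; apply/existsP; exists w.
apply/existsP; exists (i, j); rewrite Uw dw andbT /=.
rewrite !inE in iT jT; rewrite iT jT !andbT.
by apply/forall_inP => x xp; rewrite wu ?inE.
Qed.

(** A nonzero difference has a nonzero term. Following such terms performs some of the swaps of [p],
    until only the derivative along the last pair [e] is left. *)
Lemma deriv_cat1_neq0 (R : zmodType) (I C : finType) (F : {ffun I -> C} -> R)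
    p e u : deriv F (p ++ [:: e]) u != 0 ->
  exists2 s, perm_on [set x in supp p] s &
    F (swap (act u s) e) != F (act u s).
Proof.
elim: p u => [|e' p IHp] u /=.
  by rewrite subr_eq0 eq_sym => Fu; exists 1%g; rewrite ?perm_on1 ?act1.
have sub (s : {perm I}) : perm_on [set x in supp p] s ->
    perm_on [set x in supp (e' :: p)] s.
  move=> /subset_trans; apply; apply/subsetP => x; rewrite !inE => ->.
  by rewrite !orbT.
have [/IHp[s /sub son Fs] _|/negPn/eqP ->] := boolP (deriv F (p ++ [:: e]) u != 0).
  by exists s.
rewrite sub0r oppr_eq0 => /IHp[s /sub son]; rewrite [act (swap u e') s]actM => Fs.
exists (s * tperm e'.1 e'.2)%g => //.
apply: perm_onM => //; apply/subsetP => x; rewrite !inE.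
by case: tpermP => [->|->|]; rewrite ?eqxx ?orbT.
Qed.

(** * Sensitive pairs in a matching and double counting *)

Lemma prod_tperm (I : finType) (r : seq (I * I)) (S : {set I * I}) :
  uniq (supp r) ->
  (forall x, x \notin supp r ->
     (\prod_(e <- r | e \in S) tperm e.1 e.2)%g x = x) /\
  (forall e x, e \in r -> x \in [:: e.1; e.2] ->
     (\prod_(e <- r | e \in S) tperm e.1 e.2)%g x =
     if e \in S then tperm e.1 e.2 x else x).
Proof.
elim: r => [_|f r IHr /=]; first by split=> // x _; rewrite big_nil perm1.
rewrite inE negb_or => /and3P[/andP[f12 f1] f2 ur].
have [out inn] := IHr ur; split=> [x|e x].
  rewrite !inE !negb_or => /and3P[xf1 xf2 xr]; rewrite big_cons.
  by case: ifP => _; rewrite ?permM ?tpermD ?out // eq_sym.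
rewrite in_cons big_cons => /predU1P[->|er] xe.
  have nx y : y \in [:: f.1; f.2] -> y \notin supp r.
    by rewrite !inE => /orP[]/eqP ->.
  case: ifP => _; last by rewrite out ?nx.
  rewrite permM out // nx //; move: xe; rewrite !inE => /orP[]/eqP ->;
  by rewrite ?tpermL ?tpermR eqxx ?orbT.
have xr : x \in supp r by apply/suppP; exists e => //; move: xe; rewrite !inE.
have xf : tperm f.1 f.2 x = x.
  by rewrite tpermD //; [apply: contraNneq f1 => -> | apply: contraNneq f2 => ->].
by case: ifP => _; rewrite ?permM ?xf (inn e).
Qed.

(** On the cube of sets [S] of performed swaps, [g i] depends only on the pairs in [S] that meet
    [J i], of which there are at most [k]; single swaps are the singletons. *)
Lemma sensitive_matching_bound (R : realFieldType) (I C : finType)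
    (kap : C -> nat) (k N : nat) (c : 'I_N -> R)
    (g : 'I_N -> {ffun I -> C} -> R) (J : 'I_N -> {set I})
    (F : {ffun I -> C} -> R) (r : seq (I * I)) u :
  (0 < k)%N -> (forall i, depends_on (J i) (g i)) ->
  (forall i, #|J i| <= k)%N ->
  (forall v, F v = \sum_(i < N) c i * g i v) ->
  (forall v, has_counts kap v -> F v = 0 \/ F v = 1) ->
  uniq (supp r) -> has_counts kap u ->
  (count (fun e => F (swap u e) != F u) r <= k * 2 ^ k)%N.
Proof.
move=> k_gt0 gJ Jk FE F01 ur Uu.
pose cube (S : {set I * I}) :=
  act u (\prod_(e <- r | e \in S) tperm e.1 e.2)%g.
pose K i := [set e in r | (e.1 \in J i) || (e.2 \in J i)].
have bound : (#|[set e | F (cube [set e]) != F (cube set0)]| <= k * 2 ^ k)%N.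
  apply: (@sensitivity_bound R _ k N c (fun i S => g i (cube S)) K
    (fun S => F (cube S))) => //.
  - by move=> i; apply: leq_trans (card_pairs_meeting (J i) ur) _.
  - move=> i S; apply: gJ => x xJ; rewrite !ffunE; congr (u _).
    have [out1 in1] := prod_tperm S ur.
    have [out2 in2] := prod_tperm (S :&: K i) ur.
    have [/suppP[e er xe]|xr] := boolP (x \in supp r).
      have {}xe : x \in [:: e.1; e.2] by rewrite !inE.
      rewrite (in1 e) // (in2 e) // !inE er /=.
      suff -> : (e.1 \in J i) || (e.2 \in J i) by rewrite andbT.
      by move: xe; rewrite !inE => /orP[]/eqP <-; rewrite xJ ?orbT.
    by rewrite out1 ?out2.
  - by move=> S; apply: F01; rewrite has_counts_act.
apply: leq_trans bound; rewrite -size_filter.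
rewrite -(card_uniqP (filter_uniq _ (uniq_supp ur))).
apply: subset_leq_card; apply/subsetP => e; rewrite mem_filter inE.
case/andP => Fe er.
have -> : cube set0 = u.
  by rewrite /cube big_pred0 ?act1 // => f; rewrite inE.
have -> : cube [set e] = swap u e; last by [].
congr act; rewrite (eq_bigl (pred1 e)) => [|f]; last by rewrite inE.
by rewrite -big_filter filter_pred1_uniq ?uniq_supp // big_seq1.
Qed.

(** A matching of relevant pairs is built greedily; once it cannot be extended, its support serves
    as [J]. *)
Lemma matching_or_invariant (I : finType) (relevant : pred (I * I)) (M : nat) :
  (exists r, [/\ uniq (supp r), size r = M & all relevant r]) \/
  (exists2 J : {set I}, (#|J| <= M.*2)%N &
     forall i j, i \notin J -> j \notin J -> i != j -> ~~ relevant (i, j)).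
Proof.
elim: M => [|M [[r [ur sr relevant_r]]|[J leJ HJ]]]; first by left; exists [::].
- have [/existsP[e /and4P[e12 e1 e2 rele]]|none] := boolP
    [exists e : I * I, [&& e.1 != e.2, e.1 \notin supp r, e.2 \notin supp r &
       relevant e]].
    left; exists (e :: r); split; rewrite /= ?sr ?rele //.
    by rewrite inE negb_or e12 e1 e2.
  right; exists [set x in supp r] => [|i j].
    rewrite cardsE (leq_trans (card_size _)) // size_supp sr leq_double.
    exact: leqnSn.
  rewrite !inE => iJ jJ ij; apply: contra none => relij.
  by apply/existsP; exists (i, j); rewrite ij iJ jJ.
- by right; exists J => //; apply: leq_trans leJ _; rewrite leq_double.
Qed.

(** A counting form of the lower bound on the probability of sensitivity. If [z] agrees with [u0] on
    [T], some [s] moving only [T] makes [act z s] sensitive, by equivariance of [phi]. Resetting [T]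
    to [u0] recovers [z], so there are at least as many sensitive colourings as agreeing ones. *)
Lemma sensitive_card (R : zmodType) (I C : finType) (kap : C -> nat)
    (F : {ffun I -> C} -> R) (D : {set I})
    (phi : {ffun I -> C} -> {ffun I -> C}) p e (u0 : {ffun I -> C}) :
  (forall z, has_counts kap (phi z)) ->
  (forall z : {ffun I -> C}, {in D, phi z =1 z}) ->
  (forall z s, perm_on D s -> phi (act z s) = act (phi z) s) ->
  [set x in supp (p ++ [:: e])] \subset D ->
  (forall v, has_counts kap v -> {in supp (p ++ [:: e]), v =1 u0} ->
      deriv F (p ++ [:: e]) v != 0) ->
  (#|C| ^ #|I| <= #|[set z | F (swap (phi z) e) != F (phi z)]| *
     #|C| ^ (size (p ++ [:: e])).*2)%N.
Proof.
move=> Uphi phiD phis sTD Fp; set T := [set x in supp _] in sTD *.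
rewrite -(card_agree T u0).
pose reset (z : {ffun I -> C}) := [ffun x => if x \in T then u0 x else z x].
have leT : (#|T| <= (size (p ++ [:: e])).*2)%N.
  by rewrite -size_supp cardsE card_size.
have [/eqP C0|C_gt0] := posnP #|C|.
  rewrite (eq_card (B := pred0)) ?card0 ?mul0n // => z.
  have x := e.1; have := z x; move: C0 => /eqP/card0_eq C0 a.
  by have := C0 a; rewrite inE.
apply: leq_mul; last by rewrite leq_pexp2l.
apply: leq_trans (leq_imset_card reset _); apply: subset_leq_card.
apply/subsetP => z; rewrite inE => /forall_inP zu.
have /deriv_cat1_neq0[s son Fs] : deriv F (p ++ [:: e]) (phi z) != 0.
  apply: Fp => // x xT; rewrite phiD ?(eqP (zu x _)) ?inE //.
  by apply: (subsetP sTD); rewrite inE.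
have sonT : perm_on T s.
  apply: subset_trans son _; apply/subsetP => x; rewrite !inE => /suppP[f fp xf].
  by apply/suppP; exists f; rewrite // mem_cat fp.
apply/imsetP; exists (act z s).
  by rewrite inE phis //; apply: subset_trans sonT sTD.
apply/ffunP => x; rewrite !ffunE; case: ifPn => xT; first exact/eqP/zu.
by rewrite (out_perm sonT).
Qed.

Lemma total_junta (R : realFieldType) (I C : finType) (kap : C -> nat)
    (k N : nat) (c : 'I_N -> R)
    (g : 'I_N -> {ffun I -> C} -> R) (J : 'I_N -> {set I})
    (F : {ffun I -> C} -> R) (M : nat) :
  (0 < k)%N -> (forall i, depends_on (J i) (g i)) ->
  (forall i, #|J i| <= k)%N ->
  (forall v, F v = \sum_(i < N) c i * g i v) ->
  (forall v, has_counts kap v -> F v = 0 \/ F v = 1) ->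
  (k * 2 ^ k * #|C| ^ k.*2 < M)%N -> (forall a, M * k.*2 <= kap a)%N ->
  exists2 T : {set I}, (#|T| <= M.*2)%N &
    forall u v, has_counts kap u -> has_counts kap v -> {in T, u =1 v} ->
      F u = F v.
Proof.
move=> k_gt0 gJ Jk FE F01 ltM lekap.
pose relevant (e : I * I) := [exists u, has_counts kap u && (F (swap u e) != F u)].
have [[r [ur sr relevant_r]]|[T leT HT]] :=
  matching_or_invariant relevant M; last first.
  exists T => // u v Uu Uv uv; apply: (swap_connected Uu Uv uv).
  move=> w i j Uw _ iT jT; have [->|ij] := eqVneq i j; first by rewrite swap_id.
  apply/eqP; apply: contraR (HT i j iT jT ij) => Fw; apply/existsP; exists w.
  by rewrite Uw.
exfalso.
have [e0 er0] : exists e, e \in r.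
  by case: (r) sr ltM => [<-//|e r' _ _]; exists e; rewrite mem_head.
have /existsP[u /andP[Uu _]] := allP relevant_r e0 er0.
have C_gt0 : (0 < #|C|)%N by apply/card_gt0P; exists (u e0.1).
(* The condition [e \in r] is placed under the existential, with a dummy value outside [r], so that
   finite choice applies to all pairs. *)
have chain (e : I * I) : exists pu : seq (I * I) * {ffun I -> C}, e \in r ->
    (size (pu.1 ++ [:: e]) <= k)%N /\
    forall v, has_counts kap v -> {in supp (pu.1 ++ [:: e]), v =1 pu.2} ->
      deriv F (pu.1 ++ [:: e]) v != 0.
  have [er|_] := boolP (e \in r); last by exists ([::], u).
  have /existsP[w /andP[Uw Fw]] := allP relevant_r e er.
  have ue : uniq (supp [:: e]).
    rewrite /= inE andbT; apply: contraNneq Fw => e12.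
    by case: (e) e12 => i j /= ->; rewrite swap_id.
  have [|p [u0 [_ sp Hp]]] := rigid_derivative gJ Jk FE ue Uw.
    by rewrite /= subr_eq0 eq_sym.
  by exists (p, u0).
have {chain}[pu puP] : exists pu : I * I -> seq (I * I) * {ffun I -> C},
   forall e, e \in r ->
    (size ((pu e).1 ++ [:: e]) <= k)%N /\
    forall v, has_counts kap v -> {in supp ((pu e).1 ++ [:: e]), v =1 (pu e).2} ->
      deriv F ((pu e).1 ++ [:: e]) v != 0.
  by have [pu] := fin_all_exists chain; exists pu.
pose P e := (pu e).1 ++ [:: e].
pose D := [set x in flatten [seq supp (P e) | e <- r]].
have leD a : (#|D| <= kap a)%N.
  apply: leq_trans (lekap a); rewrite cardsE (leq_trans (card_size _)) //.
  rewrite size_flatten /shape -map_comp -sr sumnE big_map.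
  rewrite -sum1_size big_distrl /= big_seq [leqRHS]big_seq.
  apply: leq_sum => e er; rewrite mul1n size_supp leq_double.
  by have [] := puP e er.
have [phi [Uphi phiD phis]] := equivariant_completion Uu leD.
have low e : e \in r -> (#|C| ^ #|I| <=
    #|[set z | F (swap (phi z) e) != F (phi z)]| * #|C| ^ k.*2)%N.
  move=> er; have [sp Hp] := puP e er.
  apply: leq_trans (sensitive_card Uphi phiD phis _ Hp) _.
    apply/subsetP => x; rewrite !inE => xP; apply/flatten_mapP.
    by exists e.
  by rewrite leq_mul2l leq_pexp2l ?leq_double ?orbT.
have up z : (count (fun e => F (swap (phi z) e) != F (phi z)) r <= k * 2 ^ k)%N.
  exact: (sensitive_matching_bound k_gt0 gJ Jk FE F01 ur (Uphi z)).
(* Double counting of the pairs [(z, e)] with [phi z] sensitive to [e]: [low] bounds them below for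
   each [e], [up] above for each [z]. *)
have : (M * #|C| ^ #|I| <= k * 2 ^ k * #|C| ^ k.*2 * #|C| ^ #|I|)%N.
  apply: (@leq_trans (\sum_(e <- r) #|[set z | F (swap (phi z) e) != F (phi z)]| *
       #|C| ^ k.*2)).
    rewrite -sr -sum1_size big_distrl /= big_seq [leqRHS]big_seq.
    by apply: leq_sum => e er; rewrite mul1n low.
  rewrite -big_distrl /= mulnAC leq_mul2r; apply/orP; right.
  under eq_bigr do rewrite -sum1dep_card big_mkcond.
  rewrite exchange_big /= -card_ffun mulnC -sum_nat_const; apply: leq_sum => z _.
  by rewrite -big_mkcond sum1_count up.
by rewrite leq_pmul2r ?expn_gt0 ?C_gt0 // leqNgt ltM.
Qed.

(** * Transfer to the multislice and choice of constants *)

(** The value at [w] is copied from any multislice point agreeing with [w] on [J], and is 0 if there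
    is none; both cases depend on [w] only through [J]. *)
Lemma junta_extension (R : realType) (l : nat) (kappa : 'I_l -> nat) (m : R)
    (g : multislice kappa -> R) : is_junta m g ->
  exists Jg : {set 'I_(\sum_(i < l) kappa i)} *
      ({ffun 'I_(\sum_(i < l) kappa i) -> 'I_l} -> R),
    [/\ #|Jg.1|%:R <= m, depends_on Jg.1 Jg.2 & forall u, Jg.2 (val u) = g u].
Proof.
move=> [J [Jm gJ]].
pose G (w : {ffun 'I_(\sum_(i < l) kappa i) -> 'I_l}) : R :=
  if [pick v : {u | @in_multislice l kappa u} | [forall j in J, val v j == w j]]
    is Some v then g v else 0.
exists (J, G); split=> //= [u v uv|u].
  rewrite /G; congr (if _ is Some w then g w else 0); apply: eq_pick => w.
  by apply: eq_forallb_in => j jJ; rewrite uv.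
rewrite /G; case: pickP => [v /forall_inP vu|/(_ u)/negP[]].
  by apply: gJ => j jJ; apply/eqP/vu.
by apply/forall_inP.
Qed.

(** Both [k] and [2 ^ k] are at most [l ^ k]; this justifies [M = l ^ (4 * k) + 1]. *)
Lemma junta_size_bound (l k : nat) : (2 <= l)%N -> (0 < k)%N ->
  (k * 2 ^ k * l ^ k.*2 < (l ^ (4 * k)).+1)%N.
Proof.
move=> l2 k0; rewrite ltnS (_ : 4 * k = k + k + k.*2)%N; last by lia.
have lek : (k <= l ^ k)%N.
  by apply: leq_trans (ltnW (ltn_expl k (ltnSn 1))) _; rewrite leq_exp2r.
by rewrite !expnD; apply: leq_mul (leqnn _); apply: leq_mul; rewrite ?leq_exp2r.
Qed.

Theorem theorem4p28 (R : realType) :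
  exists C C' : R, C' <= C /\
    forall (l k : nat) (kappa : 'I_l -> nat),
      (2 <= l)%N -> (0 < k)%N -> (forall i, 0 < kappa i)%N ->
      (forall i, l%:R `^ (C * k%:R) <= (kappa i)%:R) ->
      forall f : multislice kappa -> R,
        (forall u, f u = 0 \/ f u = 1) ->
        degree_le k f ->
        is_junta (l%:R `^ (C' * k%:R)) f.
Proof.
(* With [M <= l ^ (5 * k)], the junta size [2 * M] is at most [l ^ (6 * k)], and the room
   [M * (2 * k)] required of each colour is at most [l ^ (7 * k)]. *)
exists 7, 6; split=> [|l k kappa l2 k0 _ lekap f f01 [N [c [g [gk fE]]]]].
  by rewrite ler_nat.
have powE (a : nat) : l%:R `^ (a%:R * k%:R) = (l ^ (a * k))%:R :> R.
  by rewrite -natrM powR_mulrn ?ler0n // natrX.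
have l0 : (0 < l)%N by apply: leq_trans l2.
have lek : (k <= l ^ k)%N.
  by apply: leq_trans (ltnW (ltn_expl k (ltnSn 1))) _; rewrite leq_exp2r.
have lel : (2 <= l ^ k)%N by rewrite (leq_trans l2) // -{1}(expn1 l) leq_pexp2l.
have /fin_all_exists[Jg JgP] := fun i => junta_extension (gk i).
(* [F] extends [f] to all colourings together with its junta decomposition; its values are known to
   be 0 or 1 only on the multislice. *)
pose F w := \sum_(i < N) c i * (Jg i).2 w.
have Ff (u : multislice kappa) : F (val u) = f u.
  by rewrite fE; apply: eq_bigr => i _; case: (JgP i) => _ _ ->.
set M := (l ^ (4 * k)).+1.
have leM : (M <= l ^ (5 * k))%N.
  rewrite /M (_ : 5 * k = k + 4 * k)%N; last by lia.
  rewrite expnD; apply: leq_trans (leq_mul lel (leqnn _)).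
  by rewrite mul2n -addnn -addn1 leq_add2l expn_gt0 l0.
have [||||||T leT FT] := @total_junta R _ _ kappa k N c (fun i => (Jg i).2)
    (fun i => (Jg i).1) F M k0.
- by move=> i; case: (JgP i).
- by move=> i; case: (JgP i) => + _ _; rewrite ler_nat.
- by [].
- by move=> v Uv; rewrite -[v]/(val (exist _ v Uv : multislice kappa)) Ff.
- by rewrite card_ord; apply: junta_size_bound.
- move=> a; have := lekap a; rewrite powE ler_nat; apply: leq_trans.
  rewrite (_ : 7 * k = 5 * k + (k + k))%N; last by lia.
  by rewrite expnD leq_mul // expnD -mul2n leq_mul.
exists T; split=> [|u v uv]; last first.
  by rewrite -!Ff; apply: FT uv; [exact: valP u | exact: valP v].
rewrite powE ler_nat (leq_trans leT) // -mul2n.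
rewrite (_ : 6 * k = k + 5 * k)%N; last by lia.
by rewrite expnD leq_mul.
Qed.
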